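(* Let $A$ be a unital normed algebra with identity element $I$, and let $\{T_n\}_{n\in\mathbb{N}}$ be a (discrete) semigroup in $A$. If $\limsup_{n\to\infty}\|T_n-I\|<1$, then $T_n=I$ for all $n\in\mathbb{N}$.
   Context: A (discrete) semigroup in an algebra $A$ is a family $\{T_n\}_{n\in\mathbb{N}}$ of elements of $A$ such that $T_{n+m}=T_nT_m$ for all $n,m\in\mathbb{N}$. The normed algebra $A$ is not assumed to be complete. *)

(* Defs.v *)
From mathcomp Require Import all_boot all_order all_algebra.
From mathcomp Require Import complex.
From mathcomp Require Import all_classical all_reals all_analysis.

Set Implicit Arguments.
Unset Strict Implicit.
Unset Printing Implicit Defensive.

Import Order.TTheory GRing.Theory Num.Theory.

Local Open Scope ring_scope.

Variant scalars := RealScalars | ComplexScalars.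

Definition scalar_field (R : realType) (s : scalars) : numFieldType :=
  match s with
  | RealScalars => R
  | ComplexScalars => R[i]
  end.

(* The norm of [R[i]] takes its values in [R[i]] (in its nonnegative reals);
   this is the same number as an element of [R]. *)
Definition scalar_abs (R : realType) (s : scalars) :
    scalar_field R s -> R :=
  match s with
  | RealScalars => fun k : R => `|k|
  | ComplexScalars => fun k : R[i] => complex.Re `|k|
  end.

(* A normed algebra is an [algType] with such an [N]: MathComp has no structure
   that inherits from both [normedModType] and [algType]. Neither completeness
   nor [N 1 = 1] is required. *)
Record algebra_norm (R : realType) (s : scalars)
    (A : algType (scalar_field R s)) (N : A -> R) : Prop := AlgebraNorm {
  algebra_norm_ge0 : forall x : A, 0 <= N x;
  algebra_norm_eq0 : forall x : A, N x = 0 -> x = 0;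
  algebra_normZ : forall (k : scalar_field R s) (x : A),
    N (k *: x) = scalar_abs k * N x;
  algebra_normD : forall x y : A, N (x + y) <= N x + N y;
  algebra_normM : forall x y : A, N (x * y) <= N x * N y
}.

(* [T 0 = 1] is not part of the definition. *)
Definition discrete_semigroup (A : pzSemiRingType) (T : nat -> A) : Prop :=
  forall n m : nat, T (n + m)%N = T n * T m.

(* Main.v *)
Require Import Defs.
From mathcomp Require Import all_boot all_order all_algebra.
From mathcomp Require Import complex.
From mathcomp Require Import all_classical all_reals all_analysis.
From mathcomp Require Import lra.

Set Implicit Arguments.
Unset Strict Implicit.
Unset Printing Implicit Defensive.

Import Order.TTheory GRing.Theory Num.Theory.

Local Open Scope ring_scope.

(** Put [x n = T n - 1]. The semigroup law turns [T (n + n)] into [T n ^+ 2],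
    that is [x (n + n) = x n ^+ 2 + x n + x n], so that
    [2 * N (x n) <= N (x (n + n)) + N (x n) ^+ 2]. Suppose that
    [N (x n) <= r < 1] for all [n >= m], which is what the hypothesis on the
    upper limit provides. Then [(2 - r) * N (x n) <= N (x (n + n))]: each
    doubling of the index multiplies the norm by at least [2 - r > 1]. As the
    norms along [n, 2n, 4n, ...] stay below [1], [N (x n)] has to vanish
    ([doubling_growth_eq0]). Hence [T n = 1] for all [n >= m], and for an
    arbitrary [n], [T n = T n * T m = T (n + m) = 1]. *)

(** The upper limit is the infimum of the suprema over the tails, so one of these
    suprema, which serves as [r], is already below [l]. *)
Lemma limn_esup_lt_eventually_le (R : realType) (u : nat -> \bar R)
    (l : \bar R) :
  (limn_esup u < l)%E ->
  exists2 r, (r < l)%E & \forall n \near \oo%classic, (u n <= r)%E.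
Proof.
move=> /ereal_inf_lt[_ [V nearV <-] supV_lt].
exists (ereal_sup [set u n | n in V]%classic) => //.
by apply: filterS nearV => n Vn; apply: ereal_sup_ubound; exists n.
Qed.

(** Iterating the hypothesis gives [c ^+ k * a n <= a (2 ^ k * n) <= 1]; by
    Bernoulli's inequality the factor [c ^+ k] may be replaced by
    [1 + k * (c - 1)], which the Archimedean property makes arbitrarily large. *)
Lemma doubling_growth_eq0 (R : archiRealFieldType) (a : nat -> R) (c : R) m :
    1 < c -> (forall n, 0 <= a n) ->
    (forall n, (m <= n)%N -> a n <= 1) ->
    (forall n, (m <= n)%N -> c * a n <= a (n + n)%N) ->
  forall n, (m <= n)%N -> a n = 0.
Proof.
move=> c_gt1 a_ge0 a_le1 a_double.
have bernoulli k : forall n, (m <= n)%N -> (1 + k%:R * (c - 1)) * a n <= 1.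
  elim: k => [|k IHk] n mn; first by rewrite mul0r addr0 mul1r a_le1.
  apply: le_trans (IHk (n + n)%N (leq_trans mn (leq_addr _ _))).
  have k_ge0 : 0 <= k%:R :> R := ler0n _ _.
  have d_ge0 : 0 <= c - 1 by rewrite subr_ge0 ltW.
  have kc_ge0 : 0 <= k%:R * (c - 1) by rewrite mulr_ge0.
  apply: le_trans (ler_wpM2l _ (a_double _ mn)); last by rewrite addr_ge0.
  rewrite mulrA ler_wpM2r// -natr1.
  (* [(1 + k d) (1 + d) >= 1 + (k + 1) d], where [d = c - 1] *)
  have := mulr_ge0 kc_ge0 d_ge0; lra.
move=> n mn; apply/eqP; rewrite eq_le a_ge0 andbT leNgt; apply/negP => an_gt0.
have d_gt0 : 0 < (c - 1) * a n by rewrite mulr_gt0// subr_gt0.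
have := bernoulli (Num.bound ((c - 1) * a n)^-1) n mn.
apply/negP; rewrite -ltNge mulrDl mul1r -mulrA.
have := archi_boundP (ltW (etrans (invr_gt0 _) d_gt0)).
rewrite -div1r ltr_pdivrMr// => /lt_le_trans; apply.
by rewrite lerDr ltW.
Qed.

Section AlgebraNorm.
Variables (R : realType) (s : scalars) (A : algType (scalar_field R s)).
Variables (N : A -> R) (N_norm : algebra_norm N).

(** The scalars that occur have a natural number as norm; for these the real
    and the complex case need no distinction. *)
Lemma scalar_abs_of_nat (k : scalar_field R s) n :
  `|k| = n%:R -> scalar_abs k = n%:R.
Proof.
case: s k => k; first exact.
move=> k_n; transitivity (complex.Re (n%:R : R[i])); last by rewrite raddfMn.
exact: (congr1 (@complex.Re R) k_n).
Qed.

Lemma scalar_absN1 : scalar_abs (-1 : scalar_field R s) = 1.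
Proof. exact: scalar_abs_of_nat 1%N (normrN1 _). Qed.

Lemma scalar_abs_nat n : scalar_abs (n%:R : scalar_field R s) = n%:R.
Proof. exact: scalar_abs_of_nat (normr_nat _ _). Qed.

Lemma algebra_normN x : N (- x) = N x.
Proof. by rewrite -scaleN1r (algebra_normZ N_norm) scalar_absN1 mul1r. Qed.

Lemma algebra_normMn x n : N (x *+ n) = n%:R * N x.
Proof. by rewrite -scaler_nat (algebra_normZ N_norm) scalar_abs_nat. Qed.

End AlgebraNorm.

Theorem theorem3p1 (R : realType) (s : scalars)
    (A : algType (scalar_field R s)) (N : A -> R) (N_norm : algebra_norm N)
    (T : nat -> A) (T_semigroup : discrete_semigroup T)
    (limsup_lt1 : (limn_esup (fun n : nat => (N (T n - 1)%R)%:E) < 1%:E)%E) :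
  forall n : nat, T n = 1.
Proof.
have [r r_lt1 [m _ N_le_r]] := limn_esup_lt_eventually_le limsup_lt1.
have {N_le_r} N_le n : (m <= n)%N -> ((N (T n - 1))%:E <= r)%E by exact: N_le_r.
have r_ge0 : (0 <= r)%E.
  apply: le_trans (N_le m (leqnn m)).
  by rewrite lee_fin (algebra_norm_ge0 N_norm).
case: r r_ge0 r_lt1 N_le => [r| |]//.
rewrite lee_fin lte_fin => r_ge0 r_lt1 N_le.
(* The growth factor [2 - r] exceeds [1] because [r < 1]. *)
have T_ge_m n : (m <= n)%N -> T n = 1.
  move=> mn; apply/eqP; rewrite -subr_eq0; apply/eqP/(algebra_norm_eq0 N_norm).
  move: n mn; apply: (@doubling_growth_eq0 _ _ (2 - r)).
  - by lra.
  - by move=> n; exact: (algebra_norm_ge0 N_norm).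
  - by move=> n /N_le; rewrite lee_fin => /le_trans; apply; exact: ltW.
  - move=> n /N_le; rewrite lee_fin T_semigroup; set x := T n - 1 => Nx_le_r.
    have Nx_ge0 := algebra_norm_ge0 N_norm x.
    have double_x : x *+ 2 = (T n * T n - 1) - x * x.
      have -> : T n = x + 1 by rewrite subrK.
      rewrite mulrDl mulrDr mulr1 mul1r addrA addrK.
      by rewrite -(addrA (x * x)) (addrC (x * x)) addrK.
    have : 2 * N x <= N (T n * T n - 1) + N x * N x.
      rewrite -(algebra_normMn N_norm) double_x.
      apply: le_trans (algebra_normD N_norm _ _) _.
      by rewrite lerD2l (algebra_normN N_norm) (algebra_normM N_norm).
    by have := ler_wpM2r Nx_ge0 Nx_le_r; lra.
move=> n; rewrite -[T n]mulr1 -(T_ge_m m (leqnn m)) -T_semigroup.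
by rewrite !T_ge_m// leq_addl.
Qed.
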